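(* Let $\mathscr P$ be a topological property that is preserved by preimages of spaces under perfect mappings (in the class of completely regular spaces) and is also inherited by regular closed sets. Let $(G,\tau,\oplus)$ be a strongly topological gyrogroup with a symmetric neighborhood base $\mathscr U$ at $0$, let $H$ be a locally compact admissible subgyrogroup of $G$ generated from $\mathscr U$, and suppose that the quotient space $G/H$ has the property $\mathscr P$. Then there exists an open neighborhood $U$ of the identity element $0$ in $G$ such that $\overline U$ has the property $\mathscr P$.
   Context: All topological spaces are assumed to be Hausdorff. A gyrogroup is a nonempty set $G$ with a binary operation $\oplus$ such that: (G1) there is a unique element $0\in G$ with $0\oplus a=a=a\oplus 0$ for all $a\in G$; (G2) each $x\in G$ has a unique inverse $\ominus x$ with $\ominus x\oplus x=0=x\oplus(\ominus x)$; (G3) for all $x,y\in G$ there is an automorphism $\mathrm{gyr}[x,y]$ of $(G,\oplus)$ with $x\oplus(y\oplus z)=(x\oplus y)\oplus \mathrm{gyr}[x,y](z)$ for all $z\in G$; (G4) $\mathrm{gyr}[x\oplus y,y]=\mathrm{gyr}[x,y]$ for all $x,y\in G$. For subsets, $A\oplus B=\{a\oplus b:a\in A,b\in B\}$ and $\ominus A=\{\ominus a:a\in A\}$. A subgyrogroup of $G$ is a nonempty subset closed under $\ominus$ and $\oplus$. It is an $L$-subgyrogroup if moreover $\mathrm{gyr}[a,h](H)=H$ for all $a\in G$, $h\in H$. A topological gyrogroup $(G,\tau,\oplus)$ is a gyrogroup with a topology $\tau$ such that $\oplus:G\times G\to G$ is jointly continuous and $x\mapsto\ominus x$ is continuous.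 It is a strongly topological gyrogroup with a symmetric neighborhood base $\mathscr U$ at $0$ if $\mathscr U$ is a neighborhood base of $0$ such that for every $U\in\mathscr U$, $\ominus U=U$ and $\mathrm{gyr}[x,y](U)=U$ for all $x,y\in G$. A subgyrogroup $H$ of a topological gyrogroup $G$ is admissible if there is a sequence $\{U_n:n\in\omega\}$ of open symmetric neighborhoods of $0$ with $U_{n+1}\oplus(U_{n+1}\oplus U_{n+1})\subset U_n$ for each $n\in\omega$ and $H=\bigcap_{n\in\omega}U_n$. If $G$ is a strongly topological gyrogroup with symmetric neighborhood base $\mathscr U$ at $0$ and the $U_n$ can be chosen with every $U_n\in\mathscr U$, then $H$ is said to be generated from $\mathscr U$. Such an $H$ is a closed $L$-subgyrogroup of $G$. $H$ is locally compact in the subspace topology. For an $L$-subgyrogroup $H$, $G/H=\{a\oplus H:a\in G\}$ is a partition of $G$; $\pi:G\to G/H$ is $\pi(a)=a\oplus H$, and $G/H$ carries the quotient topology ($O\subset G/H$ is open iff $\pi^{-1}(O)$ is open in $G$). A continuous mapping $f:X\to Y$ is perfect if it is closed and all fibers $f^{-1}(y)$ are compact. A subset of a space is regular closed if it is the closure of an open subset of the space. ''Preserved by preimages under perfect mappings in the class of completely regular spaces'' means: if $X,Y$ are completely regular, $f$ is a perfect mapping of $X$ onto $Y$, and $Y$ has $\mathscr P$, then $X$ has $\mathscr P$. ''Inherited by regular closed sets'' means: if $X$ has $\mathscr P$ and $F$ is regular closed in $X$, then the subspace $F$ has $\mathscr P$. *)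

(* Defs.v *)
From HB Require Import structures.
From mathcomp Require Import all_boot all_order all_algebra.
From mathcomp Require Import all_classical all_reals all_analysis.

Set Implicit Arguments.
Unset Strict Implicit.
Unset Printing Implicit Defensive.

Local Open Scope classical_set_scope.

Reserved Notation "x ⊕ y" (at level 50, left associativity).
Reserved Notation "⊖ x" (at level 35, right associativity).
Reserved Notation "A `⊕` B" (at level 50, left associativity).

Declare Scope gyro_scope.
Delimit Scope gyro_scope with gyro.
Local Open Scope gyro_scope.

(* Left cancellation forces [gyr x y z] to be [⊖(x ⊕ y) ⊕ (x ⊕ (y ⊕ z))], so
   taking the gyrations as data rather than merely as existing objects adds
   no structure. *)
HB.mixin Record isGyrogroup (G : Type) := {
  gyradd : G -> G -> G;
  gyr0 : G;
  gyropp : G -> G;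
  gyr : G -> G -> G -> G;
  gyradd0 : forall a, gyradd gyr0 a = a /\ gyradd a gyr0 = a;
  gyr0_uniq : forall e,
    (forall a, gyradd e a = a /\ gyradd a e = a) -> e = gyr0;
  gyraddN : forall x,
    gyradd (gyropp x) x = gyr0 /\ gyradd x (gyropp x) = gyr0;
  gyropp_uniq : forall x y,
    gyradd y x = gyr0 /\ gyradd x y = gyr0 -> y = gyropp x;
  gyr_bij : forall x y, bijective (gyr x y);
  gyr_morph : forall x y, {morph gyr x y : a b / gyradd a b};
  gyr_assoc : forall x y z,
    gyradd x (gyradd y z) = gyradd (gyradd x y) (gyr x y z);
  gyr_loop : forall x y, gyr (gyradd x y) y = gyr x y
}.

#[short(type="gyrogroupType")]
HB.structure Definition Gyrogroup := {G of isGyrogroup G}.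

Arguments gyr0 {s}.

Notation "x ⊕ y" := (gyradd x y) : gyro_scope.
Notation "⊖ x" := (gyropp x) : gyro_scope.

HB.mixin Record Gyrogroup_isTopological G of Gyrogroup G & Topological G := {
  gyradd_continuous : continuous (fun p : G * G => p.1 ⊕ p.2);
  gyropp_continuous : continuous (fun x : G => ⊖ x)
}.

#[short(type="topologicalGyrogroupType")]
HB.structure Definition TopologicalGyrogroup :=
  {G of Gyrogroup G & Topological G & Gyrogroup_isTopological G}.

Section gyrogroup_sets.
Context {G : gyrogroupType}.
Implicit Types A B H : set G.

Definition gyradd_set A B : set G := [set a ⊕ b | a in A & b in B].

Definition gyropp_set A : set G := [set ⊖ a | a in A].

Definition subgyrogroup H :=
  [/\ H !=set0, forall x, H x -> H (⊖ x)
    & forall x y, H x -> H y -> H (x ⊕ y)].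

Definition coset H (a : G) : set G := [set a ⊕ h | h in H].

End gyrogroup_sets.

Notation "A `⊕` B" := (gyradd_set A B) : gyro_scope.

Section strongly_topological.
Context {G : topologicalGyrogroupType}.
Implicit Types (calU : set (set G)) (H : set G).

Definition symmetric_gyr_base calU :=
  [/\ forall U, calU U -> nbhs (gyr0 : G) U,
      forall V, nbhs (gyr0 : G) V -> exists2 U, calU U & U `<=` V
    & forall U, calU U ->
        gyropp_set U = U /\ forall x y : G, gyr x y @` U = U].

Definition admissible_seq H (U : nat -> set G) :=
  [/\ forall n, open_nbhs gyr0 (U n),
      forall n, gyropp_set (U n) = U n,
      forall n, U n.+1 `⊕` (U n.+1 `⊕` U n.+1) `<=` U n
    & H = \bigcap_n U n].

Definition admissible H := subgyrogroup H /\ exists U, admissible_seq H U.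

Definition generated_from calU H :=
  exists2 U, admissible_seq H U & forall n, calU (U n).

End strongly_topological.

(* The points are the cosets themselves, so the type makes sense for every
   subset [H]; the library's quotient topology then declares [O] open exactly
   when its preimage under [a |-> a ⊕ H] is. *)
Definition coset_space (G : topologicalGyrogroupType) (H : set G) : Type :=
  set_type (range (coset H)).

Section coset_space.
Context (G : topologicalGyrogroupType) (H : set G).

Definition coset_pi (a : G) : coset_space H :=
  SigSub (mem_set (imageT (coset H) a)).

Definition coset_repr (q : coset_space H) : G := sval (cid2 (set_valP q)).

Lemma coset_reprK : cancel coset_repr coset_pi.
Proof.
move=> q; apply: val_inj => /=; rewrite /coset_repr.
by case: (cid2 _).
Qed.

HB.instance Definition _ :=
  isQuotient.Build G (coset_space H) coset_reprK.
HB.instance Definition _ :=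
  Topological.copy (coset_space H) (quotient_topology (coset_space H)).

Lemma coset_space_openE (O : set (coset_space H)) :
  open O = open (coset_pi @^-1` O).
Proof. by rewrite /open /= /quotient_open unlock. Qed.

End coset_space.

Definition homeomorphic (X Y : topologicalType) :=
  exists (f : X -> Y) (g : Y -> X),
    [/\ cancel f g, cancel g f, continuous f & continuous g].

Definition perfect_map (X Y : topologicalType) (f : X -> Y) :=
  [/\ continuous f, forall A : set X, closed A -> closed (f @` A)
    & forall y, compact (f @^-1` [set y])].

Section space_properties.
Variable P : topologicalType -> Prop.

(* All spaces under consideration are Hausdorff, so [P] is only ever
   constrained on Hausdorff spaces. *)
Definition topological_property :=
  forall X Y : topologicalType, hausdorff_space X -> hausdorff_space Y ->
    homeomorphic X Y -> P X -> P Y.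

Definition preserved_by_perfect_preimages :=
  forall (X Y : topologicalType) (f : X -> Y),
    hausdorff_space X -> completely_regular_space X ->
    hausdorff_space Y -> completely_regular_space Y ->
    perfect_map f -> range f = setT -> P Y -> P X.

Definition inherited_by_regular_closed :=
  forall (X : topologicalType) (F : set X),
    hausdorff_space X -> regclosed F -> P X -> P (set_type F).

End space_properties.

(* Main.v *)
Require Import Defs.
From HB Require Import structures.
From mathcomp Require Import all_boot all_order all_algebra.
From mathcomp Require Import all_classical all_reals all_analysis.
From mathcomp Require Import Rstruct.

(** Write [pi] for the projection of [G] onto [G/H]. It is enough to find an open
    neighbourhood [U] of the identity such that [pi], restricted to the closure
    of [U], is a perfect mapping onto a regular closed subset of [G/H]: that
    subset inherits the property from [G/H], and the closure of [U] then has it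
    as a perfect preimage. The spaces involved must also be Hausdorff and
    completely regular.

    As [H] is an intersection of gyration-invariant sets, it is itself
    gyration-invariant. So [(x ⊕ y) ⊕ H = x ⊕ (y ⊕ H)], left translations permute
    the cosets, and [pi] is an open map. Choose a compact [K] in [H] that
    contains the trace on [H] of a neighbourhood [N] of the identity, and a
    neighbourhood [V] whose relevant differences lie in [N]. For a closed subset
    [A] of [V], a point near [A] in the closure of [A ⊕ H] is already in the
    closure of [A ⊕ K], and [A ⊕ K] is closed because [K] is compact; every coset
    that meets the closure of [A ⊕ H] has a representative near [A], so [A ⊕ H]
    is closed ([small_closed_saturation]). Likewise a closed part of [V]
    meets each coset in a compact set ([small_fibre_compact]). So any [U] with
    closure in [V] makes [pi] perfect on that closure, and the image of the
    closure of [U], being closed, is the closure of the open set [pi U].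

    [G] is completely regular because gyration-invariant symmetric
    neighbourhoods [W] of the identity define a uniformity by
    [⊖ x ⊕ y \in W]. This uniformity need not descend to [G/H]. Instead, [pi] is
    open and, by translation, closed on small closed sets around every point of
    [G]; a function on [G] that separates a point from the complement of a small
    neighbourhood therefore has a continuous infimum over the fibres of [pi],
    which separates on [G/H] ([locally_closed_map_completely_regular]). Points
    of [G/H] are closed for the same reason, so [G/H] is Hausdorff. *)

Set Implicit Arguments.
Unset Strict Implicit.
Unset Printing Implicit Defensive.

Import Order.TTheory GRing.Theory Num.Theory.
Import numFieldNormedType.Exports.

Local Open Scope classical_set_scope.
Local Open Scope gyro_scope.

(** * Cancellation laws in gyrogroups *)

Section gyrogroup_theory.
Context {G : gyrogroupType}.
Implicit Types (x y z a b : G) (A H K : set G).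

Lemma gyradd0l a : gyr0 ⊕ a = a.
Proof. by have [] := gyradd0 a. Qed.

Lemma gyradd0r a : a ⊕ gyr0 = a.
Proof. by have [] := gyradd0 a. Qed.

Lemma gyraddNl a : ⊖ a ⊕ a = gyr0.
Proof. by have [] := gyraddN a. Qed.

Lemma gyraddNr a : a ⊕ ⊖ a = gyr0.
Proof. by have [] := gyraddN a. Qed.

Lemma gyr_inj x y : injective (gyr x y).
Proof. exact: bij_inj (gyr_bij x y). Qed.

Lemma gyraddI x : injective (gyradd x).
Proof.
move=> a b e; apply: (@gyr_inj (⊖ x) x).
by rewrite -[LHS]gyradd0l -[RHS]gyradd0l -(gyraddNl x) -!gyr_assoc e.
Qed.

Lemma gyr0l x z : gyr gyr0 x z = z.
Proof.
apply: (@gyraddI x); rewrite -{1}[x]gyradd0l -gyr_assoc.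
exact: gyradd0l.
Qed.

Lemma gyrNl x z : gyr (⊖ x) x z = z.
Proof. by rewrite -gyr_loop gyraddNl gyr0l. Qed.

Lemma gyraddKl x z : ⊖ x ⊕ (x ⊕ z) = z.
Proof. by rewrite gyr_assoc gyraddNl gyradd0l gyrNl. Qed.

Lemma gyroppK x : ⊖ ⊖ x = x.
Proof. by apply: (@gyraddI (⊖ x)); rewrite gyraddNl gyraddNr. Qed.

Lemma gyraddNKl x z : x ⊕ (⊖ x ⊕ z) = z.
Proof. by rewrite -{1}[x]gyroppK gyraddKl. Qed.

Lemma gyr_zero x y : gyr x y gyr0 = gyr0.
Proof.
by apply: (@gyraddI (gyr x y gyr0)); rewrite -gyr_morph !gyradd0r.
Qed.

(** The right translation by [y] is undone by adding not [⊖ y] but a gyration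
    of it. *)
Definition cosub x y := x ⊕ gyr x y (⊖ y).

(** Unlike the definition, this form is visibly continuous in both variables. *)
Lemma cosubE x y : cosub x y = x ⊕ (⊖ (x ⊕ y) ⊕ x).
Proof.
congr (_ ⊕ _); apply: (@gyraddI (x ⊕ y)).
by rewrite -gyr_assoc gyraddNr gyradd0r gyraddNKl.
Qed.

Lemma gyraddK x y : cosub (x ⊕ y) y = x.
Proof. by rewrite /cosub gyr_loop -gyr_assoc gyraddNr gyradd0r. Qed.

Lemma cosubxx x : cosub x x = gyr0.
Proof. by rewrite -{1}[x]gyradd0l gyraddK. Qed.

(** Associating [a ⊕ (b ⊕ (⊖ b ⊕ z))] in two ways shows that [gyr (a ⊕ b) u]
    inverts [gyr a b], where [u := gyr a b (⊖ b)]; the loop property turns it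
    into [gyr a u], because [(a ⊕ b) ⊕ u = a]. *)
Lemma gyr_nested a b : cancel (gyr a b) (gyr a (gyr a b (⊖ b))).
Proof.
move=> z; set u := gyr a b (⊖ b).
have su : (a ⊕ b) ⊕ u = a by rewrite -gyr_assoc gyraddNr gyradd0r.
rewrite -{1}su gyr_loop; apply: (@gyraddI ((a ⊕ b) ⊕ u)).
by rewrite -gyr_assoc -gyr_morph -gyr_assoc gyraddNKl su.
Qed.

Lemma cosubK x y : cosub x y ⊕ y = x.
Proof.
rewrite /cosub -{3}[y](gyr_nested x y) -gyr_assoc -gyr_morph.
by rewrite gyraddNl gyr_zero gyradd0r.
Qed.

Definition gyr_invariant H := forall x y, gyr x y @` H = H.

Section invariant.
Variable H : set G.
Hypothesis Hgyr : gyr_invariant H.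

Lemma gyr_invariantP x y z : H z -> H (gyr x y z).
Proof. by move=> Hz; rewrite -(Hgyr x y); exists z. Qed.

Lemma gyr_invariant_assoc x y z : H z ->
  exists2 z', H z' & (x ⊕ y) ⊕ z = x ⊕ (y ⊕ z').
Proof.
by rewrite -{1}(Hgyr x y) => -[z' Hz' <-]; exists z'; rewrite ?gyr_assoc.
Qed.

Hypothesis Hsub : subgyrogroup H.

Lemma subgyrogroup0 : H gyr0.
Proof.
case: Hsub => -[h Hh] HN HD; rewrite -(gyraddNl h).
by apply: HD => //; exact: HN.
Qed.

Lemma coset_eqP a b : coset H a = coset H b <-> exists2 h, H h & b = a ⊕ h.
Proof.
case: Hsub => _ HN HD; split=> [e|[h Hh ->]].
  have : coset H b b by exists gyr0; rewrite ?gyradd0r//; exact: subgyrogroup0.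
  by rewrite -e => -[h Hh <-]; exists h.
have sub c k : H k -> coset H (c ⊕ k) `<=` coset H c.
  move=> Hk _ [k' Hk' <-]; have [k'' Hk'' ->] := gyr_invariant_assoc c k Hk'.
  by exists (k ⊕ k'') => //; exact: HD.
apply/seteqP; split; last exact: sub.
(* [a] is itself a right translate of [a ⊕ h] by an element of [H] *)
rewrite -{1}(gyraddK a h); apply: sub.
by apply: gyr_invariantP; exact: HN.
Qed.

Lemma gyradd_set_saturated A a h : H h -> (A `⊕` H) a -> (A `⊕` H) (a ⊕ h).
Proof.
case: Hsub => _ _ HD Hh [b Ab [k Hk <-]].
have [h' Hh' ->] := gyr_invariant_assoc b k Hh.
by exists b => //; exists (k ⊕ h') => //; exact: HD.
Qed.

End invariant.
End gyrogroup_theory.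

(** * Left uniformity *)

Section topological_gyrogroup.
Context {G : topologicalGyrogroupType}.
Implicit Types (x y z : G) (A K : set G).

Lemma cvg_gyradd (T : Type) (F : set_system T) (FF : Filter F) (f g : T -> G) x y :
  f @ F --> x -> g @ F --> y -> f t ⊕ g t @[t --> F] --> x ⊕ y.
Proof.
move=> fx gy; exact: (continuous2_cvg FF (gyradd_continuous (x, y)) fx gy).
Qed.

Lemma cvg_gyropp (T : Type) (F : set_system T) (FF : Filter F) (f : T -> G) x :
  f @ F --> x -> ⊖ f t @[t --> F] --> ⊖ x.
Proof. by move=> fx; apply: continuous_cvg fx; exact: gyropp_continuous. Qed.

Lemma cvg_cosub (T : Type) (F : set_system T) (FF : Filter F) (f g : T -> G) x y :
  f @ F --> x -> g @ F --> y -> cosub (f t) (g t) @[t --> F] --> cosub x y.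
Proof.
move=> fx gy; rewrite cosubE; under eq_fun do rewrite cosubE.
by do ?[exact: fx|exact: gy|apply: cvg_gyradd|apply: cvg_gyropp].
Qed.

Lemma gyraddl_continuous x : continuous (gyradd x).
Proof. by move=> y; apply: cvg_gyradd; [exact: cvg_cst|exact: cvg_id]. Qed.

Lemma cosubr_continuous y : continuous (fun x : G => cosub x y).
Proof. by move=> x; apply: cvg_cosub; [exact: cvg_id|exact: cvg_cst]. Qed.

Lemma nbhs_gyraddl x A : nbhs x A <-> nbhs gyr0 [set u | A (x ⊕ u)].
Proof.
split=> nA; first by apply: gyraddl_continuous; rewrite gyradd0r.
have : nbhs x [set w | A (x ⊕ (⊖ x ⊕ w))].
  have : gyradd (⊖ x) w @[w --> x] --> (gyr0 : G).
    by rewrite -(gyraddNl x); exact: gyraddl_continuous.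
  by move=> /(_ _ nA).
by apply: filterS => w /=; rewrite gyraddNKl.
Qed.

Lemma closed_gyraddl x A : closed A -> closed (gyradd x @` A).
Proof.
move=> cA; rewrite [X in closed X](_ : _ = gyradd (⊖ x) @^-1` A).
  by have /continuous_closedP := @gyraddl_continuous (⊖ x); exact.
apply/seteqP; split=> [_ [a Aa <-]|w /= Aw]; first by rewrite /= gyraddKl.
by exists (⊖ x ⊕ w) => //; exact: gyraddNKl.
Qed.

(** If [z] is off [A `⊕` K], then [cosub z k] is off [A] for every [k] in [K];
    by continuity this persists near [z] and [k], and compactness of [K] makes
    one neighbourhood of [z] serve all [k]. *)
Lemma closed_gyradd_compact A K : closed A -> compact K -> closed (A `⊕` K).
Proof.
move=> cA /compact_near_coveringP cK; rewrite -openC openE => z nz.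
have : \forall z' \near z, K `<=` (fun k => (~` A) (cosub z' k)).
  apply: cK => k Kk.
  have : nbhs (cosub z k) (~` A).
    apply: open_nbhs_nbhs; split; first exact: closed_openC.
    move=> Azk; apply: nz; exists (cosub z k) => //.
    by exists k => //; exact: cosubK.
  have : cosub p.2 p.1 @[p --> (k, z)] --> cosub z k.
    by apply: cvg_cosub; [exact: cvg_snd|exact: cvg_fst].
  exact.
rewrite /interior; apply: filterS => z' Kz' [a Aa [k Kk e]].
by apply: (Kz' k Kk); rewrite -e gyraddK.
Qed.

End topological_gyrogroup.

(** The left uniformity needs gyration-invariant neighbourhoods, hence the
    dependence of this alias of [G] on the proof about [calU]. *)
Definition left_uniform (G : topologicalGyrogroupType) (calU : set (set G))
  (baseU : symmetric_gyr_base calU) : Type := G.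

Section left_uniform.
Local Open Scope relation_scope.
Variables (G : topologicalGyrogroupType) (calU : set (set G)).
Hypothesis baseU : symmetric_gyr_base calU.

Let inv U : calU U -> gyr_invariant U.
Proof. by move=> UU; case: baseU => _ _ /(_ _ UU)[]. Qed.

Let opp U x : calU U -> U x -> U (⊖ x).
Proof.
by move=> UU; case: baseU => _ _ /(_ _ UU)[eU _]; rewrite -{2}eU; exists x.
Qed.

Definition left_entourage : set_system (G * G) :=
  filter_from calU (fun U => [set xy | U (⊖ xy.1 ⊕ xy.2)]).

Let left_entourage_filter : Filter left_entourage.
Proof.
case: baseU => nU bU _; apply: filter_from_filter.
  by have [U UU _] := bU setT filterT; exists U.
move=> U V UU UV; have [W UW sW] := bU _ (filterI (nU _ UU) (nU _ UV)).
by exists W => // xy /sW.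
Qed.

Let left_entourage_diagonal A : left_entourage A -> diagonal `<=` A.
Proof.
case: baseU => nU _ _ [U UU sA] [x y] /diagonalP ->; apply: sA => /=.
by rewrite gyraddNl; exact: nbhs_singleton (nU _ UU).
Qed.

Let left_entourage_inv A : left_entourage A -> left_entourage A^-1.
Proof.
move=> [U UU sA]; exists U => // -[x y] /= Uxy; apply: sA => /=.
set u := ⊖ x ⊕ y in Uxy; have -> : y = x ⊕ u by rewrite gyraddNKl.
rewrite -{2}[x](gyraddK x u) gyraddKl gyr_loop.
by apply: (gyr_invariantP (inv UU)); exact: opp.
Qed.

Let left_entourage_split A :
  left_entourage A -> exists2 B, left_entourage B & B \; B `<=` A.
Proof.
case: baseU => nU bU _ [U UU sA].
have nP : \forall p \near ((gyr0 : G), (gyr0 : G)), U (p.1 ⊕ p.2).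
  by apply: gyradd_continuous; rewrite /= gyradd0l; exact: nU.
have [[V1 V2] /= [nV1 nV2] sV] := nP.
have [V UV sVV] := bU _ (filterI nV1 nV2).
exists [set xy | V (⊖ xy.1 ⊕ xy.2)]; first by exists V.
move=> [x y] [z /= Vxz Vzy]; apply: sA => /=.
have [v Vv e] := gyr_invariant_assoc (inv UV) x (⊖ x ⊕ z) Vzy.
rewrite !gyraddNKl in e; rewrite e gyraddKl.
by apply: (sV (_, _)); split; [case: (sVV _ Vxz)|case: (sVV _ Vv)].
Qed.

Let left_nbhsE : @nbhs G G = nbhs_ left_entourage.
Proof.
case: baseU => nU bU _; apply/funext => x; apply/seteqP; split=> A.
  move=> /nbhs_gyraddl /bU[U UU sU].
  exists [set xy | U (⊖ xy.1 ⊕ xy.2)]; first by exists U.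
  by move=> y /xsectionP /= /sU /=; rewrite gyraddNKl.
move=> [E [U UU sE] sA]; apply/nbhs_gyraddl; apply: filterS (nU _ UU) => u Uu.
by apply/sA/xsectionP/sE; rewrite /= gyraddKl.
Qed.

HB.instance Definition _ := Topological.copy (left_uniform baseU) G.
HB.instance Definition _ := @Nbhs_isUniform.Build (left_uniform baseU)
  left_entourage left_entourage_filter left_entourage_diagonal
  left_entourage_inv left_entourage_split left_nbhsE.

Lemma gyrogroup_completely_regular (R : realType) : completely_regular_space G.
Proof. exact: (@uniform_completely_regular R (left_uniform baseU)). Qed.

End left_uniform.

(** * Subspaces and complete regularity *)

Section subspaces.
Variables (X : topologicalType) (C : set X).

Lemma set_val_continuous : continuous (set_val : set_type C -> X).
Proof. exact: initial_continuous. Qed.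

Lemma closed_set_type (B : set (set_type C)) :
  closed B -> exists2 B', closed B' & B = set_val @^-1` B'.
Proof.
move=> /closed_openC[Q oQ eQ]; exists (~` Q); first exact: open_closedC.
by rewrite -[B]setCK -eQ.
Qed.

Lemma set_type_hausdorff : hausdorff_space X -> hausdorff_space (set_type C).
Proof.
move=> hX p q pq; apply: val_inj; apply: hX => A B nA nB.
have [r [Ar Br]] := pq _ _ (set_val_continuous nA) (set_val_continuous nB).
by exists (\val r).
Qed.

Lemma set_type_completely_regular (R : realType) :
  completely_regular_space X -> completely_regular_space (set_type C).
Proof.
move=> crX a B /closed_set_type[B' cB' ->] nBa.
have /(uniform_separatorP (R := R))[f [cf f01 fa fB]] :=
  crX (\val a) B' cB' nBa.
apply/(uniform_separatorP (R := R)); exists (f \o set_val); split.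
- by move=> x; apply: continuous_comp; [exact: set_val_continuous|exact: cf].
- by move=> _ [x _ <-]; apply: f01; exists (\val x).
- by move=> _ [_ -> <-]; apply: fa; exists (\val a).
- by move=> _ [x Bx <-]; apply: fB; exists (\val x).
Qed.

Lemma compact_set_val (S : set (set_type C)) :
  compact (set_val @` S) -> compact S.
Proof.
move=> cS F PF FS.
have FvS : (set_val @ F) (set_val @` S)
  by apply: (@filterS _ F _ S) => // x Sx; exists x.
have [_ [[s Ss <-] cl]] := cS _ _ FvS.
exists s; split=> // A B FA [_ [[Q oQ <-] Qs] sB].
have nQ : nbhs (set_val s) Q by exact: open_nbhs_nbhs.
have FvA : (set_val @ F) (set_val @` A)
  by apply: (@filterS _ F _ A) => // x Ax; exists x.
by have [_ [[x Ax <-] Qx]] := cl _ _ FvA nQ; exists x; split=> //; exact: sB.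
Qed.

End subspaces.

Lemma completely_regular_hausdorff (R : realType) (X : topologicalType) :
  (forall x : X, closed [set x]) -> completely_regular_space X ->
  hausdorff_space X.
Proof.
move=> T1 /(completely_regular_regular (R := R)) rX p q pq.
apply: contrapT => npq.
have /rX[B nB sB] : nbhs p (~` [set q]).
  by apply: open_nbhs_nbhs; split=> //; exact: closed_openC.
by apply: (sB q) => // D nD; exact: pq.
Qed.

(** * Mappings that are closed on small closed sets *)

Definition closed_map_on (X Y : topologicalType) (p : X -> Y) (W : set X) :=
  forall A, closed A -> A `<=` W -> closed (p @` A).

Section fibre_infimum.
Local Open Scope ring_scope.
Variables (R : realType) (X Y : topologicalType) (p : X -> Y).
Hypothesis p_surj : forall y, exists x, p x = y.

Definition fibre_inf (f : X -> R) (y : Y) : R := inf (f @` (p @^-1` [set y])).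

Variable f : X -> R.
Hypothesis f01 : range f `<=` `[0, 1].

Let f_ge0 x : 0 <= f x.
Proof. by have /= /andP[] := f01 (imageT f x). Qed.

Let f_le1 x : f x <= 1.
Proof. by have /= /andP[] := f01 (imageT f x). Qed.

Let fibre0 y : (f @` (p @^-1` [set y])) !=set0.
Proof. by have [x <-] := p_surj y; exists (f x), x. Qed.

Lemma fibre_inf_le x : fibre_inf f (p x) <= f x.
Proof.
apply: ge_inf; last by exists x.
by exists 0 => _ [x' _ <-]; exact: f_ge0.
Qed.

Lemma fibre_inf_ge c y : (forall x, p x = y -> c <= f x) -> c <= fibre_inf f y.
Proof. by move=> cf; apply: lb_le_inf => // _ [x /= pxy <-]; exact: cf. Qed.

Lemma fibre_inf_range : range (fibre_inf f) `<=` `[0, 1].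
Proof.
move=> _ [y _ <-]; rewrite /= in_itv /=; apply/andP; split.
  by apply: fibre_inf_ge => x _; exact: f_ge0.
by have [x <-] := p_surj y; exact: le_trans (fibre_inf_le x) (f_le1 x).
Qed.

(** Strict upper bounds of the infimum are open conditions because [p] is open;
    strict lower bounds [c < 1] are so because the closed set where [f <= c]
    lies in [W] and hence has a closed image. *)
Lemma fibre_inf_continuous (W : set X) :
  (forall Q, open Q -> open (p @` Q)) -> closed_map_on p W ->
  continuous f -> (forall x, ~ W x -> f x = 1) -> continuous (fibre_inf f).
Proof.
move=> p_open pW cf fW y; apply/cvgrPdist_lt => e e0.
have upper : \forall y' \near y, fibre_inf f y' < fibre_inf f y + e.
  have /(inf_lt (fibre0 y))[_ [x <- <-] fxe] : fibre_inf f y < fibre_inf f y + e.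
    by rewrite ltrDl.
  pose Q := f @^-1` [set r | r < fibre_inf f (p x) + e].
  have : nbhs (p x) (p @` Q).
    apply: open_nbhs_nbhs; split; last by exists x.
    by apply: p_open; apply: open_comp => [x' _|]; [exact: cf|exact: open_lt].
  by apply: filterS => _ [x' Qx' <-]; exact: le_lt_trans (fibre_inf_le x') Qx'.
have lower : \forall y' \near y, fibre_inf f y - e < fibre_inf f y'.
  pose c := fibre_inf f y - e / 2.
  have ltc : c < fibre_inf f y by rewrite ltrBlDr ltrDl divr_gt0.
  have ltec : fibre_inf f y - e < c.
    by rewrite ler_ltB // ltr_pdivrMr // ltr_pMr // ltr1n.
  have c1 : c < 1.
    apply: lt_le_trans ltc _.
    by have /= /andP[] := fibre_inf_range (imageT (fibre_inf f) y).
  pose A := f @^-1` [set r | r <= c].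
  have cA : closed (p @` A).
    apply: pW => [|x Ax].
      by apply: preimage_closed => [x' _|]; [exact: cf|exact: closed_le].
    by apply: contrapT => /fW fx1; move: Ax; rewrite /A /= fx1 leNgt c1.
  have : nbhs y (~` (p @` A)).
    apply: open_nbhs_nbhs; split; first exact: closed_openC.
    move=> [x Ax pxy]; rewrite -pxy in ltc.
    by have := lt_le_trans ltc (fibre_inf_le x); rewrite ltNge Ax.
  apply: filterS => y' nAy'; apply: lt_le_trans ltec _; apply: fibre_inf_ge.
  move=> x pxy'; rewrite leNgt; apply/negP => fxc; apply: nAy'.
  by exists x => //; exact: ltW.
apply: filterS2 upper lower => y' up lo.
by rewrite ltr_distlC; apply/andP.
Qed.

End fibre_infimum.

Section locally_closed_open_maps.
Variables (X Y : topologicalType) (p : X -> Y).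
Hypothesis p_surj : forall y, exists x, p x = y.
Hypothesis p_cont : continuous p.
Hypothesis p_open : forall Q, open Q -> open (p @` Q).
Hypothesis p_locally_closed :
  forall x : X, exists2 W, nbhs x W & closed_map_on p W.

(** A function on [X] that separates [x] from the complement of a small
    neighbourhood is [1] off a set on which [p] is closed, so its infimum over
    the fibres is continuous; it separates [p x] from [B] as soon as that
    neighbourhood is mapped off [B]. *)
Lemma locally_closed_map_completely_regular (R : realType) :
  completely_regular_space X -> completely_regular_space Y.
Proof.
move=> crX y B cB; have [x <-] := p_surj y => nBx.
have [W nW pW] := p_locally_closed x.
pose Q := (W `&` p @^-1` (~` B))°%classic.
have Qx : Q x.
  apply: filterI => //; apply: p_cont.
  by apply: open_nbhs_nbhs; split=> //; exact: closed_openC.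
have cQ : closed (~` Q) by apply: open_closedC; exact: open_interior.
have /(uniform_separatorP (R := R))[f [cf f01 fx fQ]] :=
  crX x _ cQ (fun n => n Qx).
have f1 x' : ~ Q x' -> f x' = 1%R by move=> nQ; apply: fQ; exists x'.
apply/(uniform_separatorP (R := R)); exists (fibre_inf p f); split.
- apply: (fibre_inf_continuous p_surj f01 p_open pW cf) => x' nW'; apply: f1.
  by move=> /interior_subset[].
- exact: fibre_inf_range.
- move=> _ [_ -> <-] /=; apply/eqP; rewrite eq_le; apply/andP; split.
    rewrite -(_ : f x = 0%R); first exact: fibre_inf_le.
    by apply: fx; exists x.
  by have /= /andP[] := fibre_inf_range p_surj f01 (imageT (fibre_inf p f) (p x)).
- move=> _ [y' By' <-] /=; apply/eqP; rewrite eq_le; apply/andP; split.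
    by have /= /andP[] := fibre_inf_range p_surj f01 (imageT (fibre_inf p f) y').
  apply: fibre_inf_ge => // x' px'; rewrite f1 // => /interior_subset[_].
  by rewrite /= px'.
Qed.

Lemma locally_closed_map_closed1 : (forall x : X, closed [set x]) ->
  forall y : Y, closed [set y].
Proof.
move=> T1 y; have [x <-] := p_surj y; rewrite -image_set1.
have [W nW pW] := p_locally_closed x.
by apply: pW => // _ ->; exact: nbhs_singleton nW.
Qed.

Lemma regclosed_image (U : set X) : open U -> closed_map_on p (closure U) ->
  regclosed (p @` closure U).
Proof.
move=> oU pU.
have cU : closed (p @` closure U) by apply: pU => //; exact: closed_closure.
apply/seteqP; split.
  apply: subset_trans (closureS (@interior_subset _ _)) _.
  by rewrite -(closure_id _).1.
apply: (@subset_trans _ (closure (p @` U))).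
  move=> _ [x clx <-] B /p_cont /clx[x' [Ux' Bx']].
  by exists (p x'); split=> //; exists x'.
apply: closureS; rewrite -open_subsetE; last exact: p_open.
by apply: image_subset; exact: subset_closure.
Qed.

End locally_closed_open_maps.

Lemma perfect_corestriction (X Y : topologicalType) (p : X -> Y) (C : set X) :
  continuous p -> closed C -> closed_map_on p C ->
  (forall y, compact (C `&` p @^-1` [set y])) ->
  exists g : set_type C -> set_type (p @` C),
    perfect_map g /\ range g = setT.
Proof.
move=> cp cC pC fib.
have gP (c : set_type C) : p (\val c) \in p @` C.
  by apply/mem_set; exists (\val c) => //; exact: set_valP.
exists (fun c => SigSub (gP c)); split; last first.
  apply/seteqP; split=> // -[y yC] _.
  have [x Cx xy] := set_mem yC; exists (SigSub (mem_set Cx)) => //.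
  exact: val_inj.
split.
- move=> c A [_ [[Q oQ <-] Qc] sA].
  have nQ : nbhs (\val c) (p @^-1` Q) by apply: cp; exact: open_nbhs_nbhs.
  apply: (@filterS _ _ _ (set_val @^-1` (p @^-1` Q))).
    by move=> c' Qc'; exact: sA.
  exact: set_val_continuous nQ.
- move=> A /closed_set_type[B cB ->].
  have cCB : closed (p @` (C `&` B)) by apply: pC; [exact: closedI|move=> x []].
  rewrite [X in closed X](_ : _ = set_val @^-1` (p @` (C `&` B))).
    by have /continuous_closedP := @set_val_continuous _ (p @` C); exact.
  apply/seteqP; split=> [_ [c Bc <-]|[y yC] /= [x [Cx Bx] xy]].
    by exists (\val c) => //; split=> //; exact: set_valP.
  by exists (SigSub (mem_set Cx)) => //; exact: val_inj.
- move=> y; apply: compact_set_val.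
  rewrite [X in compact X](_ : _ = C `&` p @^-1` [set \val y]) //.
  apply/seteqP; split=> [_ [c cy <-]|x [Cx xy]].
    by split; [exact: set_valP|rewrite -cy].
  by exists (SigSub (mem_set Cx)) => //; exact: val_inj.
Qed.

(** * The quotient by a locally compact gyration-invariant subgyrogroup *)

Section coset_quotient.
Context {G : topologicalGyrogroupType} {H : set G}.
Hypotheses (Hgyr : gyr_invariant H) (Hsub : subgyrogroup H).
Local Notation pi := (@coset_pi G H).

Lemma coset_pi_eqP a b : pi a = pi b <-> exists2 h, H h & b = a ⊕ h.
Proof.
split=> [/(congr1 val)/= /(coset_eqP Hgyr Hsub)|/(coset_eqP Hgyr Hsub) e] //.
exact: val_inj.
Qed.

Lemma coset_pi_preimage (A : set G) : pi @^-1` (pi @` A) = A `⊕` H.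
Proof.
apply/seteqP; split=> [x [a Aa /coset_pi_eqP[h Hh ->]]|_ [a Aa [h Hh <-]]].
  by exists a => //; exists h.
by exists a => //; apply/coset_pi_eqP; exists h.
Qed.

Lemma coset_pi_continuous : continuous pi.
Proof. by apply/continuousP => B; rewrite coset_space_openE. Qed.

Lemma coset_pi_surj (y : coset_space H) : exists x, pi x = y.
Proof. by exists (coset_repr y); exact: coset_reprK. Qed.

(** The saturation of [U] is the union of the preimages of [U] under the
    continuous maps [cosub ^~ h] with [h] in [H]. *)
Lemma coset_pi_open (U : set G) : open U -> open (pi @` U).
Proof.
move=> oU; rewrite coset_space_openE coset_pi_preimage openE.
move=> _ [a Ua [h Hh <-]]; rewrite /interior.
have : nbhs (a ⊕ h) [set x | U (cosub x h)].
  by apply: cosubr_continuous; rewrite gyraddK; exact: open_nbhs_nbhs.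
apply: filterS => x Ux.
by exists (cosub x h) => //; exists h => //; exact: cosubK.
Qed.

Lemma coset_pi_closed (A : set G) : closed (A `⊕` H) -> closed (pi @` A).
Proof.
move=> /closed_openC; rewrite -coset_pi_preimage -openC coset_space_openE.
exact.
Qed.

Section locally_compact.
Variables K N : set G.
Hypotheses (cK : compact K) (KH : K `<=` H).
Hypotheses (nN : nbhs (gyr0 : G) N) (NHK : N `&` H `<=` K).

(** The expression is what [a ⊕ h = (⊖ t ⊕ q) ⊕ s] yields when solved for [h]
    with [a := p]; [small] is used to put such an [h] into [N], hence into [K]. *)
Definition small (V : set G) := forall p q t s,
  V p -> V q -> V t -> V s -> N (⊖ p ⊕ ((⊖ t ⊕ q) ⊕ s)).

Lemma exists_small : exists2 V, nbhs (gyr0 : G) V & small V.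
Proof.
have : \forall x \near (((gyr0 : G), (gyr0 : G)), ((gyr0 : G), (gyr0 : G))),
    N (⊖ x.1.1 ⊕ ((⊖ x.2.1 ⊕ x.1.2) ⊕ x.2.2)).
  have e : ⊖ gyr0 ⊕ ((⊖ gyr0 ⊕ gyr0) ⊕ gyr0) = gyr0 :> G.
    by rewrite gyraddNl !gyradd0r -[LHS]gyradd0l gyraddNr.
  have c : ⊖ x.1.1 ⊕ ((⊖ x.2.1 ⊕ x.1.2) ⊕ x.2.2)
      @[x --> (((gyr0 : G), (gyr0 : G)), ((gyr0 : G), (gyr0 : G)))] --> (gyr0 : G).
    rewrite -[X in _ --> X]e.
    apply: cvg_gyradd; first by apply: cvg_gyropp; apply: cvg_comp cvg_fst cvg_fst.
    apply: cvg_gyradd; last by apply: cvg_comp cvg_snd cvg_snd.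
    apply: cvg_gyradd; last by apply: cvg_comp cvg_fst cvg_snd.
    by apply: cvg_gyropp; apply: cvg_comp cvg_snd cvg_fst.
  exact: c nN.
move=> [[P Q] /= [[[P1 P2] /= [nP1 nP2] sP] [[Q1 Q2] /= [nQ1 nQ2] sQ]] sN].
exists ((P1 `&` P2) `&` (Q1 `&` Q2)); first by do !apply: filterI.
move=> p q t s [[Pp _] _] [[_ Pq] _] [_ [Qt _]] [_ [_ Qs]].
by apply: (sN ((p, q), (t, s))); split; [exact: (sP (p, q))|exact: (sQ (t, s))].
Qed.

Variable V : set G.
Hypotheses (nV : nbhs (gyr0 : G) V) (smallV : small V).

Let V0 : V gyr0 := nbhs_singleton nV.

Lemma small_sub p q : V p -> V q -> N (⊖ p ⊕ q).
Proof.
move=> Vp Vq; have := smallV Vp Vq V0 V0.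
by rewrite gyradd0r -[⊖ gyr0]gyradd0l gyraddNr gyradd0l.
Qed.

(** Let [z] be a limit of points [a ⊕ h] with [a] in [A] and [h] in [H].
    Right translates [t ⊕ z] by small [t] are neighbours of [z], so some
    [t ⊕ z] has the form [a ⊕ h]; hence [z1 := ⊖ t ⊕ a] represents the coset of
    [z] and is close to [A]. Now [z1] is a limit of points of [A `⊕` H] too, and
    those close to it only involve elements [h] of [N], that is, of [K]. So [z1]
    lies in the closed set [A `⊕` K]. *)
Lemma small_closed_saturation (A : set G) :
  closed A -> A `<=` V -> closed (A `⊕` H).
Proof.
have [_ HN HD] := Hsub.
move=> cA AV z clz.
have nVz : nbhs z [set w | V (cosub w z)].
  by apply: cosubr_continuous; rewrite cosubxx.
have [_ [[a Aa [h Hh <-]] /= Vt]] := clz _ nVz.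
set t := cosub _ _ in Vt.
have [h1 Hh1 ez] : exists2 h1, H h1 & (⊖ t ⊕ a) ⊕ h1 = z.
  exists (gyr (⊖ t) a h); first exact: gyr_invariantP.
  by rewrite -gyr_assoc -(cosubK (a ⊕ h) z) gyraddKl.
set z1 := ⊖ t ⊕ a in ez.
(* [cosub ^~ h1] takes [z] to [z1] and maps [A `⊕` H] into itself *)
have clz1 : closure (A `⊕` H) z1.
  move=> B nB.
  have nBz : nbhs z [set w | B (cosub w h1)].
    by apply: cosubr_continuous; rewrite -ez gyraddK.
  have [w [AHw Bw]] := clz _ nBz; exists (cosub w h1); split=> //.
  by apply: gyradd_set_saturated => //; apply: gyr_invariantP => //; exact: HN.
have : closure (A `⊕` K) z1.
  move=> B nB.
  have nVz1 : nbhs z1 [set w | V (⊖ z1 ⊕ w)].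
    by apply: gyraddl_continuous; rewrite gyraddNl.
  have [_ [[a' Aa' [k Hk <-]] [/= Bw Vs]]] := clz1 _ (filterI nB nVz1).
  exists (a' ⊕ k); split=> //; exists a' => //; exists k => //; apply: NHK.
  split=> //; rewrite -(gyraddKl a' k) -(gyraddNKl z1 (a' ⊕ k)).
  by apply: smallV => //; exact: AV.
move=> /(closed_gyradd_compact cA cK)[b Ab [k Kk ebk]].
rewrite -ez; apply: gyradd_set_saturated => //.
by exists b => //; exists k => //; exact: KH.
Qed.

(** Left translation by [x] permutes the cosets of a gyration-invariant [H], so
    closedness near the identity carries over to [x]. *)
Lemma small_closed_map (x : G) : closed_map_on pi (gyradd x @` V).
Proof.
move=> A cA AxV; apply: coset_pi_closed.
pose A' := gyradd (⊖ x) @` A.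
have cA' : closed (A' `⊕` H).
  apply: small_closed_saturation; first exact: closed_gyraddl.
  by move=> _ [_ /AxV[v Vv <-] <-]; rewrite gyraddKl.
rewrite [X in closed X](_ : _ = gyradd x @` (A' `⊕` H)).
  exact: closed_gyraddl.
apply/seteqP; split=> [_ [a Aa [h Hh <-]]|_ [_ [_ [a Aa <-] [h Hh <-]] <-]].
  have [h' Hh' e] := gyr_invariant_assoc Hgyr x (⊖ x ⊕ a) Hh.
  exists ((⊖ x ⊕ a) ⊕ h'); last by rewrite -e gyraddNKl.
  by exists (⊖ x ⊕ a); [exists a|exists h'].
rewrite gyr_assoc gyraddNKl; exists a => //.
by exists (gyr x (⊖ x ⊕ a) h) => //; exact: gyr_invariantP.
Qed.

Lemma coset_pi_locally_closed (x : G) :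
  exists2 W, nbhs x W & closed_map_on pi W.
Proof.
exists (gyradd x @` V); last exact: small_closed_map.
by apply/nbhs_gyraddl; apply: filterS nV => v Vv; exists v.
Qed.

Lemma coset_space_completely_regular (R : realType) :
  completely_regular_space G -> completely_regular_space (coset_space H).
Proof.
exact: (locally_closed_map_completely_regular coset_pi_surj coset_pi_continuous
  coset_pi_open coset_pi_locally_closed).
Qed.

Lemma coset_space_closed1 : (forall x : G, closed [set x]) ->
  forall y : coset_space H, closed [set y].
Proof.
exact: (locally_closed_map_closed1 coset_pi_surj coset_pi_locally_closed).
Qed.

(** The fibre through a point [c] of [V] is [c ⊕ H], and its part in [V] lies
    in [c ⊕ K]. *)
Lemma small_fibre_compact (C : set G) (y : coset_space H) :
  closed C -> C `<=` V -> closed [set y] -> compact (C `&` pi @^-1` [set y]).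
Proof.
move=> cC CV cy.
have [->|/set0P[c [Cc /= cE]]] := eqVneq (C `&` pi @^-1` [set y]) set0.
  exact: compact0.
rewrite [X in compact X](_ : _ =
    gyradd c @` (K `&` gyradd c @^-1` (C `&` pi @^-1` [set y]))).
  apply: continuous_compact.
    exact/continuous_subspaceT/gyraddl_continuous.
  apply: compact_closedI => //.
  have /continuous_closedP := @gyraddl_continuous _ c; apply.
  apply: closedI => //.
  by have /continuous_closedP := coset_pi_continuous; apply.
apply/seteqP; split=> [x [Cx /= xE]|_ [k [_ []] Ck kE <-]] //.
have /coset_pi_eqP[h Hh ex] : pi c = pi x by rewrite cE xE.
exists h => //; split; last by rewrite -ex.
apply: NHK; split=> //; rewrite -(gyraddKl c h) -ex.
by apply: small_sub; exact: CV.
Qed.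

End locally_compact.
End coset_quotient.

Lemma locally_compact_subgyrogroup (G : topologicalGyrogroupType) (H : set G) :
  H gyr0 -> locally_compact [set: set_type H] ->
  exists K N, [/\ compact K, K `<=` H, nbhs (gyr0 : G) N & N `&` H `<=` K].
Proof.
move=> H0 /(_ (SigSub (mem_set H0)) I)[U [_ [[N oN <-] N0] sN] [cU _]].
exists (set_val @` U), N; split.
- apply: continuous_compact => //.
  exact/continuous_subspaceT/set_val_continuous.
- by move=> _ [u _ <-]; exact: set_valP.
- exact: open_nbhs_nbhs.
- by move=> x [Nx Hx]; exists (SigSub (mem_set Hx)) => //; apply: sN.
Qed.

Lemma generated_gyr_invariant (G : topologicalGyrogroupType)
    (calU : set (set G)) (H : set G) :
  symmetric_gyr_base calU -> generated_from calU H -> gyr_invariant H.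
Proof.
move=> [_ _ invU] [U [_ _ _ ->] UU] x y.
have inv n : gyr x y @` U n = U n by have [_] := invU _ (UU n).
apply/seteqP; split=> [_ [z Uz <-] n _|z Uz].
  by rewrite -inv; exists z => //; exact: Uz.
have [z' ez] : exists z', gyr x y z' = z.
  by have [g _ gK] := gyr_bij x y; exists (g z).
exists z' => // n _.
have [u Uu] : (gyr x y @` U n) z by rewrite inv; exact: Uz.
by rewrite -ez => /gyr_inj <-.
Qed.

Theorem corollary3p6 (P : topologicalType -> Prop)
    (hP : topological_property P)
    (hPperfect : preserved_by_perfect_preimages P)
    (hPreg : inherited_by_regular_closed P)
    (G : topologicalGyrogroupType) (hG : hausdorff_space G)
    (calU : set (set G)) (hcalU : symmetric_gyr_base calU)
    (H : set G) (hHadm : admissible H) (hHgen : generated_from calU H)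
    (hHlc : locally_compact [set: set_type H])
    (hPGH : P (coset_space H)) :
  exists U : set G, open_nbhs gyr0 U /\ P (set_type (closure U)).
Proof.
pose R : realType := Rdefinitions.R.
have crG := gyrogroup_completely_regular hcalU R.
have T1G : forall x : G, closed [set x].
  exact/accessible_closed_set1/hausdorff_accessible.
have Hgyr := generated_gyr_invariant hcalU hHgen.
have [Hsub _] := hHadm.
have [K [N [cK KH nN NHK]]] :=
  locally_compact_subgyrogroup (subgyrogroup0 Hsub) hHlc.
have [V nV smallV] := exists_small nN.
have crQ := coset_space_completely_regular Hgyr Hsub cK KH NHK nV smallV R crG.
have T1Q := coset_space_closed1 Hgyr Hsub cK KH NHK nV smallV T1G.
have hQ := completely_regular_hausdorff R T1Q crQ.
have [B nB BV] := completely_regular_regular (R := R) crG nV.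
pose U := interior B.
have oU : open U by exact: open_interior.
have clUV : closure U `<=` V.
  by apply: subset_trans BV; apply: closureS; exact: interior_subset.
have pU : closed_map_on (@coset_pi G H) (closure U).
  move=> A cA AU; apply: coset_pi_closed => //.
  apply: (small_closed_saturation Hgyr Hsub cK KH NHK nV smallV cA).
  exact: subset_trans clUV.
have [g [perfect_g surj_g]] :=
  perfect_corestriction (coset_pi_continuous (H := H)) (@closed_closure _ U) pU
    (fun y => small_fibre_compact Hgyr Hsub cK NHK nV smallV
                (@closed_closure _ U) clUV (T1Q y)).
exists U; split; first by split=> //; exact: nB.
apply: hPperfect perfect_g surj_g _.
- exact: set_type_hausdorff.
- exact: (set_type_completely_regular R crG).
- exact: set_type_hausdorff.
- exact: (set_type_completely_regular R crQ).
- apply: hPreg => //.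
  exact: (regclosed_image (coset_pi_continuous (H := H)) (coset_pi_open Hgyr Hsub)).
Qed.
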